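(* (Conservativity of D.LL.) For all formulas $A,B$ of the language $\mathcal{L}$ of lattice logic, if the multi-type sequent $A^\tau\vdash B_\tau$ is derivable in D.LL, then $A\vdash B$ is a theorem of the Hilbert-style presentation of lattice logic.
   Context: **Lattice logic.** The language $\mathcal{L}$ over a set $\mathsf{AtProp}$ of atomic propositions: $A::=p\mid\top\mid\bot\mid A\wedge A\mid A\vee A$. The Hilbert-style presentation has axioms $A\vdash A$, $\bot\vdash A$, $A\vdash\top$, $A\vdash A\vee B$, $B\vdash A\vee B$, $A\wedge B\vdash A$, $A\wedge B\vdash B$, and rules: from $A\vdash B$ and $B\vdash C$ infer $A\vdash C$; from $A\vdash B$ infer $A[C/p]\vdash B[C/p]$; from $A\vdash B$ and $A\vdash C$ infer $A\vdash B\wedge C$; from $A\vdash C$ and $B\vdash C$ infer $A\vee B\vdash C$. **Language of D.LL** over $\mathsf{AtProp}$. There are three types $\mathsf{L}$ (Lattice), $\mathsf{P}$ (Left), $\mathsf{P}^{\mathrm{op}}$ (Right), each with formulas and structures. - Type $\mathsf{L}$: formulas $A::=p\mid\top\mid\bot\mid ◆\alpha\mid\blacksquare\xi$; structures $X::=A\mid \mathrm{I}\mid\bullet\Gamma\mid\bullet\Pi$. - Type $\mathsf{P}$: formulas $\alpha::=\Box A\mid\alpha\cap\alpha\mid\alpha\cup\alpha$; structures $\Gamma::=\alpha\mid\circ X\mid\circledS\mid\Gamma\cdot\Gamma\mid\Gamma\supset\Gamma$. - Type $\mathsf{P}^{\mathrm{op}}$: formulas $\xi::=\Diamond A\mid\xi\cap\xi\mid\xi\cup\xi$;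 structures $\Pi::=\xi\mid\circ X\mid\circledS\mid\Pi\cdot\Pi\mid\Pi\supset\Pi$. (The connectives $\cap,\cup,\circledS,\cdot,\supset$ of type $\mathsf{P}^{\mathrm{op}}$ carry a superscript $^{\mathrm{op}}$ which is suppressed.) A sequent $x\vdash y$ has $x,y$ structures of the same type. In $x\vdash y$, $x$ is in precedent position and $y$ in succedent position; substructures inherit the position of the parent, except that the first argument of $\supset$ has the opposite position. Only sequents are considered in which $\circ X$ of type $\mathsf{P}$ and $\bullet\Pi$ occur only in succedent position, and $\circ X$ of type $\mathsf{P}^{\mathrm{op}}$ and $\bullet\Gamma$ occur only in precedent position. **Rules of D.LL.** Notation: ''premises / conclusion''; ''//'' denotes a double-line rule, usable in both directions. $X,Y$ are $\mathsf{L}$-structures, $\Gamma$ a $\mathsf{P}$-structure, $\Pi$ a $\mathsf{P}^{\mathrm{op}}$-structure. In the pure-type rules $S,T,U,V$ are structures and $s,t$ formulas, all of the same type, which is either $\mathsf{P}$ or $\mathsf{P}^{\mathrm{op}}$. - Multi-type display rules: $\Gamma\vdash\circ X$ // $\bullet\Gamma\vdash X$; $\ \circ X\vdash\Pi$ // $X\vdash\bullet\Pi$. - Pure $\mathsf{P}$/$\mathsf{P}^{\mathrm{op}}$ display rules: $S\cdot T\vdash U$ // $T\vdash S\supset U$; $\ S\vdash T\cdot U$ // $T\supset S\vdash U$. - Pure $\mathsf{P}$/$\mathsf{P}^{\mathrm{op}}$ structural rules. Cut: $S\vdash s$, $s\vdash T$ / $S\vdash T$. Unit: $S\vdash T$ //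 $S\cdot\circledS\vdash T$; $S\vdash T$ // $S\vdash T\cdot\circledS$. Exchange: $S\cdot T\vdash U$ / $T\cdot S\vdash U$; $S\vdash T\cdot U$ / $S\vdash U\cdot T$. Associativity: $(S\cdot T)\cdot U\vdash V$ // $S\cdot(T\cdot U)\vdash V$; $S\vdash(T\cdot U)\cdot V$ // $S\vdash T\cdot(U\cdot V)$. Weakening: $S\vdash T$ / $S\cdot U\vdash T$; $S\vdash T$ / $S\vdash T\cdot U$. Contraction: $S\cdot S\vdash T$ / $S\vdash T$; $S\vdash T\cdot T$ / $S\vdash T$. - Pure $\mathsf{P}$/$\mathsf{P}^{\mathrm{op}}$ operational rules: $s\cdot t\vdash S$ / $s\cap t\vdash S$; $\ S\vdash s$, $T\vdash t$ / $S\cdot T\vdash s\cap t$; $\ s\vdash S$, $t\vdash T$ / $s\cup t\vdash S\cdot T$; $\ S\vdash s\cdot t$ / $S\vdash s\cup t$. - Pure $\mathsf{L}$ rules. Id: $p\vdash p$ (axiom, $p$ atomic). Cut: $X\vdash A$, $A\vdash Y$ / $X\vdash Y$. $\mathrm{I}$-weakening: $\mathrm{I}\vdash X$ / $Y\vdash X$; $X\vdash\mathrm{I}$ / $X\vdash Y$. Constants: $\mathrm{I}\vdash X$ / $\top\vdash X$; $\mathrm{I}\vdash\top$ (axiom); $\bot\vdash\mathrm{I}$ (axiom); $X\vdash\mathrm{I}$ / $X\vdash\bot$. - Operational rules for multi-type connectives: $\circ A\vdash\Pi$ / $\Diamond A\vdash\Pi$; $\ X\vdash A$ / $\circ X\vdash\Diamond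 A$ (type $\mathsf{P}^{\mathrm{op}}$); $\ X\vdash\bullet\xi$ / $X\vdash\blacksquare\xi$; $\ \xi\vdash\Pi$ / $\blacksquare\xi\vdash\bullet\Pi$; $\ \bullet\alpha\vdash X$ / $◆\alpha\vdash X$; $\ \Gamma\vdash\alpha$ / $\bullet\Gamma\vdash ◆\alpha$; $\ \Gamma\vdash\circ A$ / $\Gamma\vdash\Box A$; $\ A\vdash X$ / $\Box A\vdash\circ X$ (type $\mathsf{P}$). **Translations** from $\mathcal{L}$-formulas to $\mathsf{L}$-type formulas of D.LL: $\top^\tau=◆\Box\top$, $\bot^\tau=◆\Box\bot$, $p^\tau=◆\Box p$, $(A\wedge B)^\tau=◆(\Box A^\tau\cap\Box B^\tau)$, $(A\vee B)^\tau=◆(\Box A^\tau\cup\Box B^\tau)$; and $\top_\tau=\blacksquare\Diamond\top$, $\bot_\tau=\blacksquare\Diamond\bot$, $p_\tau=\blacksquare\Diamond p$, $(A\wedge B)_\tau=\blacksquare(\Diamond A_\tau\cap\Diamond B_\tau)$, $(A\vee B)_\tau=\blacksquare(\Diamond A_\tau\cup\Diamond B_\tau)$ (with $\cap,\cup$ of type $\mathsf{P}^{\mathrm{op}}$ in the second group). *)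

(* Defs.v *)
From Stdlib Require Import List ClassicalEpsilon.
Import ListNotations.

Set Implicit Arguments.

Inductive form (AtProp : Type) : Type :=
| Atom (p : AtProp)
| Top
| Bot
| And (A B : form AtProp)
| Or (A B : form AtProp).

Arguments Top {AtProp}.
Arguments Bot {AtProp}.

(* [AtProp] is an arbitrary type, so atoms are compared classically. *)
Fixpoint subst (AtProp : Type) (C : form AtProp) (p : AtProp)
    (A : form AtProp) : form AtProp :=
  match A with
  | Atom q => if excluded_middle_informative (q = p) then C else Atom q
  | Top => Top
  | Bot => Bot
  | And A1 A2 => And (subst C p A1) (subst C p A2)
  | Or A1 A2 => Or (subst C p A1) (subst C p A2)
  end.

Inductive lattice_theorem (AtProp : Type) : form AtProp -> form AtProp -> Prop :=
| LT_id A : lattice_theorem A A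
| LT_bot A : lattice_theorem Bot A
| LT_top A : lattice_theorem A Top
| LT_or1 A B : lattice_theorem A (Or A B)
| LT_or2 A B : lattice_theorem B (Or A B)
| LT_and1 A B : lattice_theorem (And A B) A
| LT_and2 A B : lattice_theorem (And A B) B
| LT_trans A B C :
    lattice_theorem A B -> lattice_theorem B C -> lattice_theorem A C
| LT_subst A B C p :
    lattice_theorem A B -> lattice_theorem (subst C p A) (subst C p B)
| LT_and A B C :
    lattice_theorem A B -> lattice_theorem A C -> lattice_theorem A (And B C)
| LT_or A B C :
    lattice_theorem A C -> lattice_theorem B C -> lattice_theorem (Or A B) C.

(* [Lft] and [Rgt] are the types P and P^op. Their formulas and structures are
   indexed by [ptype], so that the connectives and rules common to the two
   types are given once; type L has its own formulas and structures.
   [BDia] and [BBox] are the black diamond and the black square. *)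
Inductive ptype : Set := Lft | Rgt.

Inductive lfm (AtProp : Type) : Type :=
| LAtom (p : AtProp)
| LTop
| LBot
| BDia (a : pfm AtProp Lft)
| BBox (x : pfm AtProp Rgt)
with pfm (AtProp : Type) : ptype -> Type :=
| Box (A : lfm AtProp) : pfm AtProp Lft
| Dia (A : lfm AtProp) : pfm AtProp Rgt
| Cap t (a b : pfm AtProp t) : pfm AtProp t
| Cup t (a b : pfm AtProp t) : pfm AtProp t.

Arguments LTop {AtProp}.
Arguments LBot {AtProp}.

Inductive lstr (AtProp : Type) : Type :=
| LForm (A : lfm AtProp)
| SI
| Bul t (S : pstr AtProp t)
with pstr (AtProp : Type) : ptype -> Type :=
| PForm t (a : pfm AtProp t) : pstr AtProp t
| Circ t (X : lstr AtProp) : pstr AtProp t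
| SUnit t : pstr AtProp t
| Dot t (S T : pstr AtProp t) : pstr AtProp t
| Imp t (S T : pstr AtProp t) : pstr AtProp t.

Arguments SI {AtProp}.
Arguments Circ {AtProp t} X.
Arguments SUnit {AtProp t}.

Inductive sequent (AtProp : Type) : Type :=
| SeqL (X Y : lstr AtProp)
| SeqP t (S T : pstr AtProp t).

Declare Scope dll_scope.
Delimit Scope dll_scope with dll.

Notation "X ⊢ₗ Y" := (SeqL X Y) (at level 70, no associativity) : dll_scope.
Notation "S ⊢ₚ T" := (SeqP S T) (at level 70, no associativity) : dll_scope.
Notation "S ⊙ T" := (Dot S T) (at level 50, left associativity) : dll_scope.
Notation "S ⊃ T" := (Imp S T) (at level 55, right associativity) : dll_scope.

Inductive position : Set := Prec | Succ.

Definition opp (o : position) : position :=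
  match o with Prec => Succ | Succ => Prec end.

(* [bul_pos t] (resp. [circ_pos t]) is the only position in which the
   structural connective [Bul] on type [t] (resp. [Circ] into type [t]) may
   occur. *)
Definition bul_pos (t : ptype) : position :=
  match t with Lft => Prec | Rgt => Succ end.

Definition circ_pos (t : ptype) : position :=
  match t with Lft => Succ | Rgt => Prec end.

Fixpoint wf_lstr (AtProp : Type) (o : position) (X : lstr AtProp) : Prop :=
  match X with
  | LForm _ => True
  | SI => True
  | @Bul _ t T => o = bul_pos t /\ wf_pstr o T
  end
with wf_pstr (AtProp : Type) (o : position) (t : ptype) (S : pstr AtProp t)
    : Prop :=
  match S with
  | PForm _ => True
  | @Circ _ t X => o = circ_pos t /\ wf_lstr o X
  | SUnit => True
  | Dot S1 S2 => wf_pstr o S1 /\ wf_pstr o S2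
  | Imp S1 S2 => wf_pstr (opp o) S1 /\ wf_pstr o S2
  end.

Definition wf_sequent (AtProp : Type) (s : sequent AtProp) : Prop :=
  match s with
  | SeqL X Y => wf_lstr Prec X /\ wf_lstr Succ Y
  | SeqP S1 S2 => wf_pstr Prec S1 /\ wf_pstr Succ S2
  end.

Section Rules.
Local Open Scope dll_scope.
Local Coercion LForm : lfm >-> lstr.
Local Coercion PForm : pfm >-> pstr.

(* Double-line rules: [double_rule u l] has upper sequent [u] and lower
   sequent [l]. *)
Inductive double_rule (AtProp : Type)
    : sequent AtProp -> sequent AtProp -> Prop :=
| D_bul_l (G : pstr AtProp Lft) X : double_rule (G ⊢ₚ Circ X) (Bul G ⊢ₗ X)
| D_bul_r X (P : pstr AtProp Rgt) : double_rule (Circ X ⊢ₚ P) (X ⊢ₗ Bul P)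
| D_res_l t (S T U : pstr AtProp t) : double_rule (S ⊙ T ⊢ₚ U) (T ⊢ₚ S ⊃ U)
| D_res_r t (S T U : pstr AtProp t) : double_rule (S ⊢ₚ T ⊙ U) (T ⊃ S ⊢ₚ U)
| D_unit_l t (S T : pstr AtProp t) : double_rule (S ⊢ₚ T) (S ⊙ SUnit ⊢ₚ T)
| D_unit_r t (S T : pstr AtProp t) : double_rule (S ⊢ₚ T) (S ⊢ₚ T ⊙ SUnit)
| D_assoc_l t (S T U V : pstr AtProp t) :
    double_rule ((S ⊙ T) ⊙ U ⊢ₚ V) (S ⊙ (T ⊙ U) ⊢ₚ V)
| D_assoc_r t (S T U V : pstr AtProp t) :
    double_rule (S ⊢ₚ (T ⊙ U) ⊙ V) (S ⊢ₚ T ⊙ (U ⊙ V)).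

Inductive rule (AtProp : Type) : list (sequent AtProp) -> sequent AtProp -> Prop :=
| R_down s s' : double_rule s s' -> rule [s] s'
| R_up s s' : double_rule s s' -> rule [s'] s
| R_cutP t (S T : pstr AtProp t) (s : pfm AtProp t) :
    rule [S ⊢ₚ s; s ⊢ₚ T] (S ⊢ₚ T)
| R_exch_l t (S T U : pstr AtProp t) : rule [S ⊙ T ⊢ₚ U] (T ⊙ S ⊢ₚ U)
| R_exch_r t (S T U : pstr AtProp t) : rule [S ⊢ₚ T ⊙ U] (S ⊢ₚ U ⊙ T)
| R_weak_l t (S T U : pstr AtProp t) : rule [S ⊢ₚ T] (S ⊙ U ⊢ₚ T)
| R_weak_r t (S T U : pstr AtProp t) : rule [S ⊢ₚ T] (S ⊢ₚ T ⊙ U)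
| R_contr_l t (S T : pstr AtProp t) : rule [S ⊙ S ⊢ₚ T] (S ⊢ₚ T)
| R_contr_r t (S T : pstr AtProp t) : rule [S ⊢ₚ T ⊙ T] (S ⊢ₚ T)
| R_cap_l t (s u : pfm AtProp t) (S : pstr AtProp t) :
    rule [s ⊙ u ⊢ₚ S] (Cap s u ⊢ₚ S)
| R_cap_r t (s u : pfm AtProp t) (S T : pstr AtProp t) :
    rule [S ⊢ₚ s; T ⊢ₚ u] (S ⊙ T ⊢ₚ Cap s u)
| R_cup_l t (s u : pfm AtProp t) (S T : pstr AtProp t) :
    rule [s ⊢ₚ S; u ⊢ₚ T] (Cup s u ⊢ₚ S ⊙ T)
| R_cup_r t (s u : pfm AtProp t) (S : pstr AtProp t) :
    rule [S ⊢ₚ s ⊙ u] (S ⊢ₚ Cup s u)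
| R_id (p : AtProp) : rule [] (LAtom p ⊢ₗ LAtom p)
| R_cutL X Y (A : lfm AtProp) : rule [X ⊢ₗ A; A ⊢ₗ Y] (X ⊢ₗ Y)
| R_Iweak_l X Y : rule [SI ⊢ₗ X] (Y ⊢ₗ X)
| R_Iweak_r X Y : rule [X ⊢ₗ SI] (X ⊢ₗ Y)
| R_top_l X : rule [SI ⊢ₗ X] (LTop ⊢ₗ X)
| R_top_r : rule [] (SI ⊢ₗ LTop)
| R_bot_l : rule [] (LBot ⊢ₗ SI)
| R_bot_r X : rule [X ⊢ₗ SI] (X ⊢ₗ LBot)
| R_dia_l (A : lfm AtProp) (P : pstr AtProp Rgt) :
    rule [Circ A ⊢ₚ P] (Dia A ⊢ₚ P)
| R_dia_r X (A : lfm AtProp) : rule [X ⊢ₗ A] (Circ X ⊢ₚ Dia A)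
| R_bbox_r X (x : pfm AtProp Rgt) : rule [X ⊢ₗ Bul x] (X ⊢ₗ BBox x)
| R_bbox_l (x : pfm AtProp Rgt) (P : pstr AtProp Rgt) :
    rule [x ⊢ₚ P] (BBox x ⊢ₗ Bul P)
| R_bdia_l (a : pfm AtProp Lft) X : rule [Bul a ⊢ₗ X] (BDia a ⊢ₗ X)
| R_bdia_r (G : pstr AtProp Lft) (a : pfm AtProp Lft) :
    rule [G ⊢ₚ a] (Bul G ⊢ₗ BDia a)
| R_box_r (G : pstr AtProp Lft) (A : lfm AtProp) :
    rule [G ⊢ₚ Circ A] (G ⊢ₚ Box A)
| R_box_l (A : lfm AtProp) X : rule [A ⊢ₗ X] (Box A ⊢ₚ Circ X).

End Rules.

(* Only well-formed sequents are considered in D.LL, so every sequent of a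
   derivation, premises included, must satisfy [wf_sequent]. *)
Inductive derivable (AtProp : Type) : sequent AtProp -> Prop :=
| Derive ps s :
    rule ps s -> wf_sequent s -> (forall q, In q ps -> derivable q) ->
    derivable s.

Fixpoint tau_up (AtProp : Type) (A : form AtProp) : lfm AtProp :=
  match A with
  | Atom p => BDia (Box (LAtom p))
  | Top => BDia (Box LTop)
  | Bot => BDia (Box LBot)
  | And A B => BDia (Cap (Box (tau_up A)) (Box (tau_up B)))
  | Or A B => BDia (Cup (Box (tau_up A)) (Box (tau_up B)))
  end.

Fixpoint tau_down (AtProp : Type) (A : form AtProp) : lfm AtProp :=
  match A with
  | Atom p => BBox (Dia (LAtom p))
  | Top => BBox (Dia LTop)
  | Bot => BBox (Dia LBot)
  | And A B => BBox (Cap (Dia (tau_down A)) (Dia (tau_down B)))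
  | Or A B => BBox (Cup (Dia (tau_down A)) (Dia (tau_down B)))
  end.

(* Main.v *)
Require Import Defs.
From Stdlib Require Import List Classical.

(** D.LL is sound for a semantics in which an [L]-type expression denotes an
    ideal of the preorder [lattice_theorem] (the syntactic lattice), and a
    [P]- or [P^op]-type expression denotes an arbitrary set of formulas.  Sets
    of formulas form a Boolean algebra, so the pure [P] and [P^op] rules are
    classical propositional logic, with the residual of [⊙] read as implication
    in succedent position and as difference in precedent position.  The two
    multi-type adjunctions are
    - ideals generated by sets, left adjoint to the inclusion of ideals into
      sets (black diamond and box);
    - upper bounds of an ideal, adjoint to the set of common lower bounds
      (diamond and black square).
    In the second the order on sets is reversed; the sets are complemented in
    order to make inclusion the order of both types, so that all the rules
    shared by the two types have one reading and one soundness proof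
    ([rule_sound]).

    Ideals are used because they have arbitrary joins, which the syntactic
    lattice may lack, while a finite join of principal ideals remains principal.
    Hence both translations of a formula [A] denote the principal ideal of [A]
    ([tau_up_principal], [tau_down_principal]), and derivability of the
    translated sequent says that the principal ideal of [A] is included in that
    of [B], that is, that [A ⊢ B] is a theorem. *)

Section Semantics.

Variable AtProp : Type.

Notation form := (form AtProp).
Notation "A ≤ B" := (lattice_theorem A B) (at level 70).

(** * Ideals of the syntactic lattice and the two adjunctions *)

Definition incl (S T : form -> Prop) : Prop := forall C, S C -> T C.

Record ideal (I : form -> Prop) : Prop := {
  ideal_bot : I Bot;
  ideal_or : forall A B, I A -> I B -> I (Or A B);
  ideal_down : forall A B, A ≤ B -> I B -> I A
}.

Definition principal (A : form) : form -> Prop := fun C => C ≤ A.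

Definition generated (S : form -> Prop) : form -> Prop :=
  fun C => forall I, ideal I -> incl S I -> I C.

(** On the right-hand type, [S] stands for its complement, so the common lower
    bounds are those of the formulas outside [S]. *)
Definition to_ideal (t : ptype) (S : form -> Prop) : form -> Prop :=
  match t with
  | Lft => generated S
  | Rgt => fun C => forall D, ~ S D -> C ≤ D
  end.

(** On the right-hand type this is the complement of the set of upper bounds
    of [I]. *)
Definition of_ideal (t : ptype) (I : form -> Prop) : form -> Prop :=
  match t with
  | Lft => I
  | Rgt => fun D => ~ incl I (principal D)
  end.

Lemma ideal_principal A : ideal (principal A).
Proof.
  split; unfold principal.
  - apply LT_bot.
  - intros; apply LT_or; assumption.
  - intros B C HBC HC; exact (LT_trans HBC HC).
Qed.

Lemma ideal_to_ideal t S : ideal (to_ideal t S).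
Proof.
  destruct t; simpl; split.
  - intros I HI _; apply (ideal_bot _ HI).
  - intros A B HA HB I HI HS; exact (ideal_or _ HI A B (HA I HI HS) (HB I HI HS)).
  - intros A B HAB HB I HI HS; exact (ideal_down _ HI A B HAB (HB I HI HS)).
  - intros D _; apply LT_bot.
  - intros A B HA HB D HD; apply LT_or; auto.
  - intros A B HAB HB D HD; exact (LT_trans HAB (HB D HD)).
Qed.

Lemma to_ideal_Lft_adjoint S I :
  ideal I -> (incl S (of_ideal Lft I) <-> incl (to_ideal Lft S) I).
Proof.
  intros HI; split; intros H C HC.
  - exact (HC I HI H).
  - apply H; intros J _ HJ; exact (HJ C HC).
Qed.

Lemma of_ideal_Rgt_adjoint I S :
  incl (of_ideal Rgt I) S <-> incl I (to_ideal Rgt S).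
Proof.
  split; simpl; intros H.
  - intros C HC D HD.
    destruct (classic (incl I (principal D))) as [HI|HI].
    + exact (HI C HC).
    + destruct HD; exact (H D HI).
  - intros D HD; apply NNPP; intros HS; apply HD.
    intros C HC; exact (H C HC D HS).
Qed.

(** * Interpretation of formulas and structures *)

Fixpoint lfm_den (A : lfm AtProp) : form -> Prop :=
  match A with
  | LAtom p => principal (Atom p)
  | LTop => principal Top
  | LBot => principal Bot
  | BDia a => to_ideal Lft (pfm_den Lft a)
  | BBox x => to_ideal Rgt (pfm_den Rgt x)
  end
with pfm_den (t : ptype) (a : pfm AtProp t) : form -> Prop :=
  match a with
  | Box A => of_ideal Lft (lfm_den A)
  | Dia A => of_ideal Rgt (lfm_den A)
  | @Cap _ t a b => fun C => pfm_den t a C /\ pfm_den t b C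
  | @Cup _ t a b => fun C => pfm_den t a C \/ pfm_den t b C
  end.

(** [Bul] and [Circ] are each tied by well-formedness to one position per type,
    hence to one operator; the remaining structural connectives have one reading
    in each position. *)
Fixpoint lstr_den (o : position) (X : lstr AtProp) : form -> Prop :=
  match X with
  | LForm A => lfm_den A
  | SI => match o with Prec => principal Top | Succ => principal Bot end
  | @Bul _ t G => to_ideal t (pstr_den o t G)
  end
with pstr_den (o : position) (t : ptype) (S : pstr AtProp t) : form -> Prop :=
  match S with
  | @PForm _ t a => pfm_den t a
  | @Circ _ t X => of_ideal t (lstr_den o X)
  | SUnit => fun _ => match o with Prec => True | Succ => False end
  | @Dot _ t G H => fun C =>
      match o with
      | Prec => pstr_den o t G C /\ pstr_den o t H C
      | Succ => pstr_den o t G C \/ pstr_den o t H C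
      end
  | @Imp _ t G H => fun C =>
      match o with
      | Prec => ~ pstr_den (opp o) t G C /\ pstr_den o t H C
      | Succ => pstr_den (opp o) t G C -> pstr_den o t H C
      end
  end.

Definition valid (s : sequent AtProp) : Prop :=
  match s with
  | SeqL X Y => incl (lstr_den Prec X) (lstr_den Succ Y)
  | @SeqP _ t G H => incl (pstr_den Prec t G) (pstr_den Succ t H)
  end.

(** Two rules need this: display for [Bul] on the left-hand type, whose adjunction
    holds only for ideals, and weakening from a succedent [I], which needs [Bot]
    to belong to every denotation. *)
Lemma ideal_lstr_den o X : ideal (lstr_den o X).
Proof.
  destruct X as [A| |t G]; simpl.
  - destruct A; simpl; try apply ideal_principal.
    + exact (ideal_to_ideal Lft _).
    + exact (ideal_to_ideal Rgt _).
  - destruct o; apply ideal_principal.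
  - apply ideal_to_ideal.
Qed.

(** * Soundness *)

Lemma double_rule_sound s s' : double_rule s s' -> (valid s <-> valid s').
Proof.
  destruct 1; cbn [valid].
  - apply to_ideal_Lft_adjoint, ideal_lstr_den.
  - apply of_ideal_Rgt_adjoint.
  - unfold incl; simpl; firstorder.
  - unfold incl; simpl; split; intros H C HC.
    + destruct HC as [HT HS]; destruct (H C HS); tauto.
    + destruct (classic (pstr_den Succ t T C)); auto.
  - unfold incl; simpl; firstorder.
  - unfold incl; simpl; firstorder.
  - unfold incl; simpl; firstorder.
  - unfold incl; simpl; split; intros H C HC; specialize (H C HC); tauto.
Qed.

Lemma rule_sound ps s : rule ps s -> Forall valid ps -> valid s.
Proof.
  intros Hr Hps; destruct Hr;
    repeat match goal with
    | H : Forall _ (_ :: _) |- _ =>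
        let H1 := fresh "Hprem" in apply Forall_cons_iff in H as [H1 H]
    end; clear Hps.
  1: { apply (double_rule_sound s s'); assumption. }
  1: { apply (double_rule_sound s s'); assumption. }
  all: cbn [valid] in *.
  (* Cuts and Boolean rules, and monotonicity of [to_ideal] and [of_ideal] for
     the rules introducing a multi-type connective on both sides. *)
  all: try (unfold incl in *; simpl in *; firstorder; fail).
  - (* [Y ⊢ X] from [I ⊢ X] *)
    intros C _; apply Hprem, LT_top.
  - (* [X ⊢ Y] from [X ⊢ I] *)
    intros C HC; apply (ideal_down _ (ideal_lstr_den Succ Y) C Bot).
    + exact (Hprem C HC).
    + apply ideal_bot, ideal_lstr_den.
Qed.

Lemma derivable_valid s : derivable s -> valid s.
Proof.
  induction 1 as [ps s Hr _ _ IH].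
  apply (rule_sound ps s Hr), Forall_forall, IH.
Qed.

(** * Translated formulas denote principal ideals *)

Definition same (S T : form -> Prop) : Prop := forall C, S C <-> T C.

Lemma and_lower_bound (A B C : form) : C ≤ And A B <-> C ≤ A /\ C ≤ B.
Proof.
  split.
  - intros H; split; [exact (LT_trans H (LT_and1 A B))
                     |exact (LT_trans H (LT_and2 A B))].
  - intros [HA HB]; exact (LT_and HA HB).
Qed.

Lemma or_upper_bound (A B C : form) : Or A B ≤ C <-> A ≤ C /\ B ≤ C.
Proof.
  split.
  - intros H; split; [exact (LT_trans (LT_or1 A B) H)
                     |exact (LT_trans (LT_or2 A B) H)].
  - intros [HA HB]; exact (LT_or HA HB).
Qed.

(** The ideal generated by [S] need not be principal; it is as soon as it
    contains an upper bound of [S]. *)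
Lemma generated_principal S A :
  incl S (principal A) -> generated S A ->
  same (to_ideal Lft S) (principal A).
Proof.
  intros HS HA C; split.
  - intros HC; exact (HC _ (ideal_principal A) HS).
  - intros HC; exact (ideal_down _ (ideal_to_ideal Lft S) C A HC HA).
Qed.

Lemma lower_bounds_principal S A :
  (forall D, ~ S D -> A ≤ D) -> (forall C, (forall D, ~ S D -> C ≤ D) -> C ≤ A) ->
  same (to_ideal Rgt S) (principal A).
Proof.
  intros HS HA C; split.
  - apply HA.
  - intros HC D HD; exact (LT_trans HC (HS D HD)).
Qed.

(** Black square after diamond closes an ideal to the intersection of the
    principal ideals above it, which is the identity only on such
    intersections; principal ideals are all that the translation needs. *)
Lemma of_ideal_Rgt_principal I A D :
  same I (principal A) -> (of_ideal Rgt I D <-> ~ A ≤ D).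
Proof.
  intros HI; simpl; split; intros H HA; apply H.
  - intros C HC; exact (LT_trans (proj1 (HI C) HC) HA).
  - apply HA, HI, LT_id.
Qed.

(** The intersection of two principal ideals is already the principal ideal of
    the meet, whereas their union only generates that of the join. *)
Lemma tau_up_principal A : same (lfm_den (tau_up A)) (principal A).
Proof.
  induction A as [p| | |A IHA B IHB|A IHA B IHB]; apply generated_principal.
  1, 3, 5: intros C HC; exact HC.
  1-3: intros I _ HI; exact (HI _ (LT_id _)).
  - intros C [HA HB]; apply and_lower_bound; split;
      [exact (proj1 (IHA C) HA)|exact (proj1 (IHB C) HB)].
  - intros I _ HI; apply HI; split;
      [apply IHA, LT_and1|apply IHB, LT_and2].
  - intros C [HC|HC].
    + exact (LT_trans (proj1 (IHA C) HC) (LT_or1 A B)).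
    + exact (LT_trans (proj1 (IHB C) HC) (LT_or2 A B)).
  - intros I HI HS; apply (ideal_or _ HI); apply HS;
      [left; apply IHA, LT_id|right; apply IHB, LT_id].
Qed.

(** Complements turn conjunction of sets of non-upper-bounds into union of sets
    of upper bounds: its common lower bounds are those below both [A] and [B].
    Dually, disjunction leaves the upper bounds common to [A] and [B], whose
    greatest lower bound is [Or A B]. *)
Lemma tau_down_principal A : same (lfm_den (tau_down A)) (principal A).
Proof.
  assert (Hgen : forall E, same (to_ideal Rgt (of_ideal Rgt (principal E)))
                                (principal E)).
  { intros E; apply lower_bounds_principal.
    - intros D HD; apply NNPP; intros H; apply HD.
      apply (of_ideal_Rgt_principal _ E); [intros C; tauto|exact H].
    - intros C HC; apply HC; intros H; apply H; intros D HD; exact HD. }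
  induction A as [p| | |A IHA B IHB|A IHA B IHB].
  1-3: apply Hgen.
  all: pose proof (fun D => of_ideal_Rgt_principal _ A D IHA) as HA;
    pose proof (fun D => of_ideal_Rgt_principal _ B D IHB) as HB;
    apply lower_bounds_principal; cbn [pfm_den].
  - intros D HD; rewrite HA, HB in HD.
    destruct (classic (A ≤ D)) as [H|H].
    + exact (LT_trans (LT_and1 A B) H).
    + apply (LT_trans (LT_and2 A B)), NNPP; tauto.
  - intros C HC; apply and_lower_bound; split; apply HC; rewrite HA, HB;
      intros [H1 H2]; [apply H1|apply H2]; apply LT_id.
  - intros D HD; rewrite HA, HB in HD.
    apply or_upper_bound; split; apply NNPP; tauto.
  - intros C HC; apply HC; rewrite HA, HB.
    intros [H|H]; apply H; [apply LT_or1|apply LT_or2].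
Qed.

End Semantics.

Theorem mainTheorem3 (AtProp : Type) (A B : form AtProp) :
  derivable (SeqL (LForm (tau_up A)) (LForm (tau_down B))) ->
  lattice_theorem A B.
Proof.
  intros H; apply (tau_down_principal AtProp B).
  apply (derivable_valid AtProp _ H), tau_up_principal, LT_id.
Qed.
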